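(* Let $u^\dagger\in\mathcal X$ and $\eta^\dagger\in\mathbb R^K$, and let $y^\dagger=Au^\dagger+\eta^\dagger$. Let an initial ensemble $u^{(j)}(0)\in\mathcal X$, $j=1,\dots,J$, be given, and let $\mathcal X_0$ denote the linear span of $\{u^{(j)}(0)\}_{j=1}^J$. Then, for every $T>0$, the system of ordinary differential equations $$\frac{\mathrm d u^{(j)}}{\mathrm d t}=\frac1J\sum_{k=1}^J\bigl\langle A(u^{(k)}-\overline u),\,y^\dagger-Au^{(j)}\bigr\rangle_\Gamma\,(u^{(k)}-\overline u),\qquad j=1,\dots,J,$$ where $\overline u=\frac1J\sum_{k=1}^J u^{(k)}$, with the given initial values $u^{(j)}(0)$, has a unique solution $u^{(j)}(\cdot)\in C([0,T);\mathcal X_0)$, $j=1,\dots,J$.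
   Context: $\mathcal X$ is a separable Hilbert space, $K,J\in\mathbb N$, $A\in\mathcal L(\mathcal X,\mathbb R^K)$ is a bounded linear operator, and $\Gamma\in\mathbb R^{K\times K}$ is symmetric positive definite. For $a,b\in\mathbb R^K$, $\langle a,b\rangle_\Gamma=\langle\Gamma^{-1/2}a,\Gamma^{-1/2}b\rangle$ with $\langle\cdot,\cdot\rangle$ the Euclidean inner product. *)

(* Defs.v *)
From HB Require Import structures.
From mathcomp Require Import all_boot all_order all_algebra.
From mathcomp Require Import all_classical all_reals all_analysis.
From mathcomp.real_closed Require complex.

Set Implicit Arguments.
Unset Strict Implicit.
Unset Printing Implicit Defensive.

Import Order.TTheory GRing.Theory Num.Theory.
Import numFieldNormedType.Exports.

Local Open Scope classical_set_scope.
Local Open Scope ring_scope.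

Definition separable (T : topologicalType) : Prop :=
  exists S : set T, countable S /\ dense S.

(* With X complete, this makes X a real Hilbert space with inner product
   [ip] (symmetric, bilinear and positive definite by its type). *)
Definition norm_of_inner (R : realType) (X : normedModType R)
    (ip : {dot X for (@idfun R)}) : Prop :=
  forall x : X, `|x| ^+ 2 = ip x x.

(* For W = 'cV[R]_K the library norm is the sup norm, which is equivalent to the
   Euclidean one. *)
Definition bounded_op (R : realType) (V W : normedModType R)
    (A : {linear V -> W}) : Prop :=
  exists M : R, forall x : V, `|A x| <= M * `|x|.

Section Weighted.
Variables (R : realType) (K : nat).
Implicit Types (Gamma : 'M[R]_K) (a b : 'cV[R]_K).

Definition edot a b : R := \sum_(i < K) a i 0 * b i 0.

Definition posdefmx Gamma : Prop :=
  Gamma^T = Gamma /\ forall a, a != 0 -> 0 < edot a (Gamma *m a).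

(* The symmetric positive definite square root; the default value 0 of [xget]
   is never used when [Gamma] is positive definite, see [sqrtmxP] and
   [sqrtmx_unique]. *)
Definition sqrtmx Gamma : 'M[R]_K :=
  xget 0 [set S | posdefmx S /\ S *m S = Gamma].

Definition wdot Gamma a b : R :=
  edot (invmx (sqrtmx Gamma) *m a) (invmx (sqrtmx Gamma) *m b).

End Weighted.

Section SqrtFacts.
Import complex.
Variable R : realType.

Lemma edotE K (a b : 'cV[R]_K) : edot a b = (a^T *m b) 0 0.
Proof. by rewrite /edot mxE; apply: eq_bigr => i _; rewrite mxE. Qed.

Lemma edot_ge0 K (a : 'cV[R]_K) : 0 <= edot a a.
Proof. by apply: sumr_ge0 => i _; rewrite -expr2 sqr_ge0. Qed.

Lemma edot_eq0 K (a : 'cV[R]_K) : edot a a = 0 -> a = 0.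
Proof.
move/eqP; rewrite psumr_eq0 => [/allP a0|i _]; last by rewrite -expr2 sqr_ge0.
apply/matrixP => i j; rewrite ord1 mxE.
by have /implyP/(_ isT) := a0 i (mem_index_enum i); rewrite mulf_eq0 orbb => /eqP.
Qed.

Local Lemma interp (s : seq R) (f : R -> R) :
  exists p : {poly R}, forall x, x \in s -> p.[x] = f x.
Proof.
elim: s => [|x s [p hp]]; first by exists 0.
have [/hp px|xs] := boolP (x \in s).
  by exists p => z; rewrite inE => /predU1P[->|/hp].
pose q := \prod_(y <- s) ('X - y%:P).
have qx : q.[x] != 0 by rewrite -/(root _ _) root_prod_XsubC.
exists (p + ((f x - p.[x]) / q.[x]) *: q) => z; rewrite inE !hornerE.
case/predU1P => [->|zs]; first by rewrite divfK// addrC subrK.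
have /eqP-> : q.[z] == 0 by rewrite -/(root _ _) root_prod_XsubC.
by rewrite mulr0 addr0 hp.
Qed.

Local Lemma trmx_horner K (G : 'M[R]_K.+1) p :
  G^T = G -> (horner_mx G p)^T = horner_mx G p.
Proof.
move=> Gs; elim/poly_ind: p => [|p c ih]; first by rewrite !rmorph0 trmx0.
rewrite !(rmorphD, rmorphM)/= horner_mx_X horner_mx_C.
rewrite linearD/= tr_scalar_mx; congr (_ + _).
rewrite -mulmxE trmx_mul ih Gs.
by apply: comm_mx_horner.
Qed.

Local Lemma eigen_gt0 K (G : 'M[R]_K) r :
  posdefmx G -> root (char_poly G) r -> 0 < r.
Proof.
move=> [Gs Gp]; rewrite -eigenvalue_root_char => /eigenvalueP[v vG v0].
have vt0 : v^T != 0 by rewrite -trmx0 (inj_eq trmx_inj).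
have := Gp _ vt0.
have -> : G *m v^T = r *: v^T by rewrite -{1}Gs -trmx_mul vG linearZ.
rewrite edotE -scalemxAr mxE -edotE pmulr_lgt0 // lt_neqAle edot_ge0 andbT eq_sym.
by apply: contra vt0 => /eqP/edot_eq0->.
Qed.

Local Lemma root4 K (G : 'M[R]_K) : posdefmx G ->
  exists T : 'M[R]_K, T^T = T /\ (T *m T) *m (T *m T) = G.
Proof.
case: K G => [|K] G Gpd.
  by exists 0; split; apply/matrixP => -[].
pose C : numClosedFieldType := complex R.
pose f : {rmorphism R -> C} := @real_complex_def R (Phant R).
pose Gc : 'M[C]_K.+1 := map_mx f G.
have finj : injective f by exact: fmorph_inj.
have freal x : f x \is Num.real.
  rewrite realE /f /=  !lecE /= !eqxx /=. 
  by have := num_real x; rewrite realE.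
have Gherm : Gc \is hermsymmx.
  apply: realsym_hermsym.
    apply/is_hermitianmxP; rewrite expr0 scale1r map_mx_id// /Gc map_trmx.
    by case: Gpd => ->.
  by apply/mxOverP => i j; rewrite mxE.
have := hermitian_spectral_diag_real Gherm.
have /orthomx_spectralP := hermitian_normalmx Gherm.
set P := spectralmx Gc; set d := spectral_diag Gc => GE dreal.
have Pu : P \in unitmx by exact: spectral_unit.
have dE i : exists2 r : R, d 0 i = f r & 0 < r.
  have /mxOverP/(_ 0 i) := dreal.
  case dz: (d 0 i) => [a b] abr.
  have b0 : b = 0.
    by move: abr; rewrite realE !lecE /= => /orP[] /andP[/eqP ->].
  exists a; first by rewrite b0.
  apply: (eigen_gt0 Gpd); rewrite -(fmorph_root f) map_char_poly -/Gc.
  rewrite -eigenvalue_root_char; apply/eigenvalueP; exists (row i P).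
    rewrite {1}GE !mulmxA -row_mul mulmxV// -row_mul mul1mx.
    apply/rowP => j; rewrite !mxE (bigD1 i)//= !mxE eqxx mulr1n big1 ?addr0.
      by rewrite dz b0.
    by move=> k ki; rewrite !mxE eq_sym (negPf ki) mulr0n mul0r.
  apply/eqP => /(congr1 (mulmx^~ (invmx P))).
  rewrite -row_mul mulmxV// mul0mx => /rowP/(_ i).
  by rewrite !mxE eqxx => /eqP; rewrite oner_eq0.
pose r i := xget 0 [set r : R | d 0 i = f r].
have rE i : d 0 i = f (r i).
  rewrite /r; case: xgetP => //= nr; have [a da _] := dE i.
  by have := nr a; rewrite /= da.
have r0 i : 0 < r i.
  by have [a da a0] := dE i; have := rE i; rewrite da => /finj <-.
have [p hp] := interp [seq r i | i : 'I_K.+1] (fun x => Num.sqrt (Num.sqrt x)).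
exists (horner_mx G p); split; first by apply: trmx_horner; case: Gpd.
apply: (map_mx_inj (f := f)).
rewrite !mulmxE -!rmorphM/= map_horner_mx -/Gc GE.
rewrite horner_mx_uconjC// horner_mx_diag; congr (_ *m _ *m _).
congr diag_mx; apply/rowP => i; rewrite mxE rE horner_map. apply: (congr1 f).
have ri : r i \in [seq r i | i : 'I_K.+1] by apply: map_f; rewrite mem_enum.
rewrite !hornerM hp// -!expr2 !sqr_sqrtr ?sqrtr_ge0 //.
exact: ltW.
Qed.

Lemma sqrtmx_exists K (G : 'M[R]_K) : posdefmx G ->
  exists S : 'M[R]_K, posdefmx S /\ S *m S = G.
Proof.
move=> Gpd; have [T [Ts TG]] := root4 Gpd.
exists (T *m T); split=> //; split; first by rewrite trmx_mul Ts.
move=> a a0; rewrite edotE -mulmxA mulmxA -{1}Ts -trmx_mul -edotE.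
rewrite lt_neqAle edot_ge0 andbT eq_sym; apply: contra a0 => /eqP/edot_eq0 Ta.
have [_ Gp] := Gpd; apply/eqP; apply: contrapT => /eqP/Gp.
by rewrite -TG -!mulmxA Ta !mulmx0 edotE mulmx0 mxE ltxx.
Qed.

Lemma sqrtmx_unique K (S S' : 'M[R]_K) :
  posdefmx S -> posdefmx S' -> S *m S = S' *m S' -> S = S'.
Proof.
move=> [Ss Sp] [Ss' Sp'] SS.
apply/eqP; rewrite -subr_eq0; set D := S - S'.
have Ds : D^T = D by rewrite /D linearB /= Ss Ss'.
have trE (M : 'M[R]_K) : \tr (D *m M *m D) = \sum_j edot (col j D) (M *m col j D).
  rewrite /mxtrace; apply: eq_bigr => j _.
  rewrite edotE mulmxA tr_col Ds -!row_mul colE mulmxA.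
  by rewrite -colE !mxE.
have ge0 (M : 'M[R]_K) : posdefmx M -> forall a, 0 <= edot a (M *m a).
  move=> [_ Mp] a; have [->|/Mp/ltW//] := eqVneq a 0.
  by rewrite mulmx0 edotE mulmx0 mxE.
have : \tr (D *m S *m D) + \tr (D *m S' *m D) = 0.
  rewrite (mxtrace_mulC (D *m S') D) -mulmxA -mxtraceD -mulmxDr.
  rewrite (_ : S *m D + D *m S' = 0) ?mulmx0 ?mxtrace0//.
  by rewrite mulmxBr mulmxBl SS addrA subrK subrr.
rewrite !trE; set a := \sum_j _; set b := \sum_j _ => /eqP.
have a0 : 0 <= a by apply: sumr_ge0 => j _; apply: ge0.
have b0 : 0 <= b by apply: sumr_ge0 => j _; apply: ge0.
rewrite paddr_eq0// => /andP[/eqP az _].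
apply/eqP/matrixP => i j; rewrite [RHS]mxE.
move/eqP: az; rewrite psumr_eq0 => [/allP az|k _]; last exact: ge0.
have /implyP/(_ isT)/eqP e := az j (mem_index_enum j).
have [/colP/(_ i)|/Sp] := eqVneq (col j D) 0; first by rewrite !mxE.
by rewrite e ltxx.
Qed.

Lemma sqrtmxP K (G : 'M[R]_K) : posdefmx G ->
  posdefmx (sqrtmx G) /\ sqrtmx G *m sqrtmx G = G.
Proof.
move=> /sqrtmx_exists[S hS]; rewrite /sqrtmx.
by case: xgetP => [_ ->//|/(_ S)].
Qed.

End SqrtFacts.

Section Ensemble.
Variables (R : realType) (X : normedModType R) (K J : nat).
Implicit Types (u : 'I_J -> X) (U : 'I_J -> R -> X).

Definition span_of u : set X :=
  [set x | exists c : 'I_J -> R, x = \sum_(j < J) c j *: u j].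

Definition emean u : X := J%:R^-1 *: \sum_(k < J) u k.

Definition enkf_rhs (A : {linear X -> 'cV[R]_K}) (Gamma : 'M[R]_K)
    (y : 'cV[R]_K) u (j : 'I_J) : X :=
  J%:R^-1 *: \sum_(k < J)
    wdot Gamma (A (u k - emean u)) (y - A (u j)) *: (u k - emean u).

(* Only the values of [U] on [0, T[ matter: the derivative is two-sided for
   0 < t < T and one-sided at t = 0. *)
Definition enkf_solution (A : {linear X -> 'cV[R]_K}) (Gamma : 'M[R]_K)
    (y : 'cV[R]_K) (u0 : 'I_J -> X) (T : R) U : Prop :=
  let F t j := enkf_rhs A Gamma y (fun k => U k t) j in
  forall j,
  [/\ {within `[0, T[, continuous (U j)},
      forall t : R, 0 <= t < T -> span_of u0 (U j t),
      U j 0 = u0 j,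
      forall t : R, 0 < t < T -> is_derive t 1 (U j) (F t j) &
      h^-1 *: (U j h - U j 0) @[h --> 0^'+] --> F 0 j].

End Ensemble.

(* Main.v *)
Require Import Defs.
From HB Require Import structures.
From mathcomp Require Import all_boot all_order all_algebra.
From mathcomp Require Import all_classical all_reals all_analysis.
From mathcomp.real_closed Require complex.
From mathcomp Require Import ring lra.

(** Existence comes from an explicit solution, uniqueness from Gronwall.

    Existence. In coordinates [C] with respect to the initial ensemble, that is
    with u^(j) = sum_i C_ji u^(i)(0), the flow reads
      C' = J^-1 (W - C Q) (P C)^T (P C),   C(0) = 1,
    where P is the centering projection, Q the Gram matrix of the vectors
    A u^(i)(0) for the weighted inner product, and W has all its rows equal to
    the weighted inner products of the data with these vectors
    ([enkf_rhs_combination]). Working with coordinates keeps the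
    solution in the span of the initial ensemble and works also when the
    initial vectors are linearly dependent. Put G = 2 J^-1 P Q P, which is
    symmetric and positive semidefinite. The deviations from the mean satisfy
    a matrix Riccati-like equation which is solved by P C = P h with
    h(t) = (1 + t G)^(-1/2), whence (P C)^T (P C) = P h^2. What remains is
    linear in C and is solved by
      C(t) = 1 - J^-1 (Q - W) P k(t),   k(t) = int_0^t h(s)^3 ds.
    Since G is positive semidefinite, h and k exist for all t >= 0, which
    is why there is no blow-up ([psd_matrix_flow], [coef_flow]). The matrix
    functions h and k of G are taken in a real eigenbasis of G; the scalar
    primitive of (1 + a s)^(-3/2) is [kappa].

    Uniqueness. The right-hand side is built from bounded linear maps, sums
    and products, so it is Lipschitz on bounded sets ([enkf_rhs_lipschitz]).
    Two solutions are bounded on [0, t] for every t < T, so the sum phi of the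
    squared Hilbert norms of their differences satisfies phi' <= c phi and
    vanishes at 0; by [gronwall] it vanishes on [0, t] ([ode_unique]). *)

Set Implicit Arguments.
Unset Strict Implicit.
Unset Printing Implicit Defensive.

Import Order.TTheory GRing.Theory Num.Theory.
Import numFieldNormedType.Exports.

Local Open Scope classical_set_scope.
Local Open Scope ring_scope.

(** * Diagonalization and functional calculus of symmetric matrices *)

Section Spectral.
Import complex.
Variable R : realType.

(** Over the complex numbers the spectral theorem yields a diagonalization
    with real eigenvalues. Two real matrices that are similar over the complex
    numbers are similar over the reals, so the eigenbasis can be chosen real;
    orthogonality of the basis is lost on the way, see [trmx_specfun]. *)
Lemma symmetric_diagonalizable n (G : 'M[R]_n) : G^T = G ->
  exists (B : 'M[R]_n) (d : 'rV[R]_n),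
    B \in unitmx /\ B *m G = diag_mx d *m B.
Proof.
move=> Gs.
pose C : numClosedFieldType := complex R.
pose f : {rmorphism R -> C} := @real_complex_def R (Phant R).
have freal x : f x \is Num.real.
  rewrite realE /f /= !lecE /= !eqxx /=.
  by have := num_real x; rewrite realE.
have realE (z : C) : z \is Num.real -> z = f (Re z).
  case: z => a b; rewrite realE !lecE /= => abr.
  by have -> : b = 0 by move: abr => /orP[] /andP[/eqP ->].
pose Gc : 'M[C]_n := map_mx f G.
have Greal : Gc \is a mxOver Num.real by apply/mxOverP => i j; rewrite mxE.
have Gherm : Gc \is hermsymmx.
  apply: realsym_hermsym => //.
  apply/is_hermitianmxP; rewrite expr0 scale1r map_mx_id// /Gc map_trmx.
  by rewrite Gs.
have dreal := hermitian_spectral_diag_real Gherm.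
have /orthomx_spectralP GE := hermitian_normalmx Gherm.
pose d : 'rV[R]_n := map_mx (@Re R) (spectral_diag Gc).
have dE : spectral_diag Gc = map_mx f d.
  apply/matrixP => i j; rewrite !mxE; move: (mxOverP dreal i j).
  exact: realE.
have sim : similar_in unitmx Gc (diag_mx (map_mx f d)).
  exists (spectralmx Gc); first exact: spectral_unit.
  apply/similarP; first exact: spectral_unit.
  by rewrite {2}GE !mulmxA mulmxV ?spectral_unit// mul1mx dE.
have [|Bc /andP[/mxOverP Breal Bu] simB] := real_similar sim Greal.
  by rewrite -map_diag_mx; apply/mxOverP => i j; rewrite mxE.
pose B : 'M[R]_n := map_mx (@Re R) Bc.
have BE : Bc = map_mx f B.
  apply/matrixP => i j; rewrite !mxE; move: (Breal i j).
  exact: realE.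
exists B, d; split; first by move: Bu; rewrite BE map_unitmx.
apply: (map_mx_inj (f := f)); rewrite !map_mxM map_diag_mx -BE.
exact/(similarP Bu).
Qed.

End Spectral.

Section SpectralCalculus.
Variables (R : realType) (n : nat) (G B : 'M[R]_n) (d : 'rV[R]_n).
Hypotheses (Bu : B \in unitmx) (BG : B *m G = diag_mx d *m B).

(** The matrix f(G) of the functional calculus. *)
Definition specfun (f : R -> R) : 'M[R]_n :=
  invmx B *m diag_mx (map_mx f d) *m B.

Lemma mul_specfun f : B *m specfun f = diag_mx (map_mx f d) *m B.
Proof. by rewrite /specfun !mulmxA mulmxV// mul1mx. Qed.

Lemma specfun_id : specfun id = G.
Proof. by rewrite /specfun map_mx_id// -mulmxA -BG mulmxA mulVmx// mul1mx. Qed.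

Lemma specfun1 : specfun (fun=> 1) = 1%:M.
Proof.
rewrite /specfun; have -> : map_mx (fun=> 1 : R) d = const_mx 1 :> 'rV[R]_n.
  by apply/matrixP => i j; rewrite !mxE.
by rewrite diag_const_mx mulmx1 mulVmx.
Qed.

Lemma specfunM f g : specfun f *m specfun g = specfun (fun x => f x * g x).
Proof.
rewrite -[LHS]mulmxA mul_specfun mulmxA -(mulmxA (invmx B)).
rewrite mulmx_diag /specfun; congr (_ *m diag_mx _ *m _).
by apply/rowP => i; rewrite !mxE.
Qed.

Lemma specfunB f g : specfun f - specfun g = specfun (fun x => f x - g x).
Proof.
rewrite /specfun -mulmxBl -mulmxBr -linearB; congr (_ *m diag_mx _ *m _).
by apply/rowP => i; rewrite !mxE.
Qed.

Lemma specfunZ c f : c *: specfun f = specfun (fun x => c * f x).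
Proof.
rewrite /specfun scalemxAl scalemxAr -linearZ; congr (_ *m diag_mx _ *m _).
by apply/rowP => i; rewrite !mxE.
Qed.

Lemma specfun_eq f g : (forall i, f (d 0 i) = g (d 0 i)) ->
  specfun f = specfun g.
Proof.
by move=> fg; congr (_ *m diag_mx _ *m _); apply/rowP => i; rewrite !mxE.
Qed.

(** A matrix that commutes with [diag_mx d] has no entry linking two distinct
    values of [d], and [f] agrees on equal values. *)
Lemma diag_mx_comm_map f (M : 'M[R]_n) :
  M *m diag_mx d = diag_mx d *m M ->
  M *m diag_mx (map_mx f d) = diag_mx (map_mx f d) *m M.
Proof.
move=> Md; apply/matrixP => i j; have /matrixP/(_ i j) := Md.
rewrite !mul_mx_diag !mul_diag_mx !mxE.
have [-> _|dij /eqP] := eqVneq (d 0 i) (d 0 j); first by rewrite mulrC.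
rewrite mulrC -subr_eq0 -mulrBl mulf_eq0 subr_eq0 eq_sym (negPf dij)/=.
by move/eqP ->; rewrite mul0r mulr0.
Qed.

Lemma specfun_comm f (M : 'M[R]_n) :
  M *m G = G *m M -> M *m specfun f = specfun f *m M.
Proof.
move=> MG.
have /(diag_mx_comm_map f) cM : B *m M *m invmx B *m diag_mx d =
    diag_mx d *m (B *m M *m invmx B).
  rewrite (_ : diag_mx d = B *m G *m invmx B); last by rewrite BG mulmxK.
  by rewrite !mulmxA !mulmxKV// -!(mulmxA B) MG.
apply: (can_inj (mulKmx Bu)); rewrite [RHS]mulmxA mul_specfun.
have iBu : invmx B \in unitmx by rewrite unitmx_inv.
apply: (can_inj (mulmxK iBu)).
have fE : specfun f *m invmx B = invmx B *m diag_mx (map_mx f d).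
  by rewrite /specfun mulmxK.
by rewrite -(mulmxA B) -(mulmxA M) fE !mulmxA cM !mulmxA.
Qed.

(** The eigenbasis need not be orthogonal, but symmetry of [G] makes
    [B *m B^T] commute with the diagonal matrix, hence with its image by [f]. *)
Lemma trmx_specfun f : G^T = G -> (specfun f)^T = specfun f.
Proof.
move=> Gs.
have /(diag_mx_comm_map f) cB : B *m B^T *m diag_mx d = diag_mx d *m (B *m B^T).
  rewrite mulmxA -BG -[LHS]mulmxA -(tr_diag_mx d) -trmx_mul -BG.
  by rewrite trmx_mul Gs mulmxA.
apply: (can_inj (mulKmx Bu)).
have tBu : B^T \in unitmx by rewrite unitmx_tr.
apply: (can_inj (mulmxK tBu)).
rewrite mul_specfun -[RHS]mulmxA -cB -!mulmxA; congr (_ *m _).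
by rewrite -trmx_mul mul_specfun trmx_mul tr_diag_mx.
Qed.

(** The rows of [B] are left eigenvectors of [G]. *)
Lemma specfun_diag_ge0 : G^T = G ->
  (forall a : 'cV[R]_n, 0 <= edot a (G *m a)) -> forall i, 0 <= d 0 i.
Proof.
move=> Gs Gp i; have := Gp (row i B)^T.
have -> : G *m (row i B)^T = d 0 i *: (row i B)^T.
  rewrite -{1}Gs -trmx_mul -row_mul BG row_mul row_diag_mx -scalemxAl.
  by rewrite -rowE linearZ.
rewrite edotE -scalemxAr mxE -edotE pmulr_lge0//.
rewrite lt_neqAle edot_ge0 andbT eq_sym; apply/eqP => /edot_eq0 /(congr1 trmx).
rewrite trmxK trmx0 => /(congr1 (mulmx^~ (invmx B))).
rewrite -row_mul mulmxV// mul0mx => /rowP/(_ i).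
by rewrite !mxE eqxx => /eqP; rewrite oner_eq0.
Qed.

Lemma is_derive_specfun (f : R -> R -> R) (df : R -> R) (t : R) i j :
  (forall l, is_derive t 1 (f ^~ (d 0 l)) (df (d 0 l))) ->
  is_derive t 1 (fun s => specfun (f s) i j) (specfun df i j).
Proof.
move=> fd.
have spE g : specfun g i j = \sum_l invmx B i l * B l j * g (d 0 l).
  rewrite /specfun mxE; apply: eq_bigr => l _.
  by rewrite mul_mx_diag !mxE mulrAC.
rewrite spE (_ : (fun s => _) = \sum_l (invmx B i l * B l j \*: f ^~ (d 0 l))).
  exact: is_derive_sum.
by apply/funext => s; rewrite spE fct_sumE.
Qed.

End SpectralCalculus.

(** * The explicit flow in coordinates *)

Section ScalarFlow.
Variable R : realType.
Implicit Types a t : R.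

(** The integral of (1 + a s)^(-3/2) over 0 <= s <= t, written so as to cover
    [a = 0], where the usual primitive -2 / (a sqrt(1 + a s)) breaks down. *)
Definition kappa t a : R :=
  let s := Num.sqrt (1 + a * t) in 2 * t / (s * (s + 1)).

Lemma kappaE a t : 0 <= a -> 0 <= t ->
  1 - 2^-1 * (a * kappa t a) = (Num.sqrt (1 + a * t))^-1.
Proof.
move=> a0 t0; rewrite /kappa /=; set s := Num.sqrt _.
have at1 : 0 < 1 + a * t by rewrite ltr_wpDr// mulr_ge0.
have s0 : 0 < s by rewrite sqrtr_gt0.
have s2 : a * t = s ^+ 2 - 1 by rewrite sqr_sqrtr ?ltW// addrC addKr.
have -> : 2^-1 * (a * (2 * t / (s * (s + 1)))) = a * t / (s * (s + 1)).
  by field; rewrite !gt_eqF//; lra.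
by rewrite s2; field; rewrite !gt_eqF//; lra.
Qed.

Lemma is_derive_kappa a t : 0 <= a -> 0 <= t ->
  is_derive t 1 (kappa ^~ a) ((Num.sqrt (1 + a * t))^-1 ^+ 3).
Proof.
move=> a0 t0; set s := Num.sqrt _.
have at1 : 0 < 1 + a * t by rewrite ltr_wpDr// mulr_ge0.
have s0 : 0 < s by rewrite sqrtr_gt0.
have s2 : a * t = s ^+ 2 - 1 by rewrite sqr_sqrtr ?ltW// addrC addKr.
have dl : is_derive t 1 (fun x : R => 1 + a * x) a.
  apply: is_derive_eq.
  by rewrite add0r mul1r; exact: mulr1.
have ds : is_derive t 1 (fun x : R => Num.sqrt (1 + a * x)) ((2 * s)^-1 * a).
  exact: (is_derive1_comp (f := Num.sqrt) (g := fun x : R => 1 + a * x)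
    (is_derive1_sqrt at1) dl).
pose q (x : R) := Num.sqrt (1 + a * x) * (Num.sqrt (1 + a * x) + 1).
have q0 : q t != 0 by rewrite mulf_neq0// gt_eqF// ltr_wpDr.
have dq : is_derive t 1 q (s * ((2 * s)^-1 * a) + (s + 1) * ((2 * s)^-1 * a)).
  have ds1 := is_deriveD ds (is_derive_cst (1 : R) t 1).
  apply: (is_derive_eq (is_deriveM ds ds1)).
  by rewrite addr0.
apply: (is_derive_eq
  (is_deriveM (is_deriveZ 2 (is_derive_id t 1)) (is_deriveV q0 dq))).
rewrite /q -/s /GRing.scale/= mulr1.
have s1 : s + 1 != 0 by rewrite gt_eqF// addr_gt0.
have s0' : s != 0 by rewrite gt_eqF.
transitivity ((2 * (s * (s + 1)) - (2 * s + 1) * (a * t) / s) /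
              (s * (s + 1)) ^+ 2).
  by rewrite -[2 *: t]/(2 * t); field; rewrite s1 s0'.
by rewrite s2; field; rewrite s1 s0'.
Qed.
End ScalarFlow.

(** Here k = int h^3 and h = (1 + t G)^(-1/2); the last clause is the integral
    form 1 - (1/2) int G h^3 of the equation h' = - (1/2) G h^3. *)
Lemma psd_matrix_flow (R : realType) n (G : 'M[R]_n) :
  G^T = G -> (forall a : 'cV[R]_n, 0 <= edot a (G *m a)) ->
  exists k : R -> 'M[R]_n,
  [/\ k 0 = 0, forall t, (k t)^T = k t,
      forall t M, M *m G = G *m M -> M *m k t = k t *m M &
      forall (t : R) i j, 0 <= t ->
        let h := 1%:M - 2^-1 *: (G *m k t) in
        is_derive t 1 (fun s => k s i j) ((h *m h *m h) i j)].
Proof.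
move=> Gs Gp; have [B [d [Bu BG]]] := symmetric_diagonalizable Gs.
have d0 := specfun_diag_ge0 Bu BG Gs Gp.
exists (fun t => specfun B d (kappa t)); split.
- rewrite /specfun (_ : map_mx _ d = 0) ?linear0 ?mulmx0 ?mul0mx//.
  by apply/rowP => i; rewrite !mxE /kappa mulr0 mul0r.
- by move=> t; exact: (trmx_specfun Bu BG).
- by move=> t M; exact: (specfun_comm Bu BG).
move=> t i j t0.
have -> : 1%:M - 2^-1 *: (G *m specfun B d (kappa t)) =
    specfun B d (fun a => (Num.sqrt (1 + a * t))^-1).
  rewrite -{1}(specfun_id Bu BG) -(specfun1 d Bu) (specfunM _ Bu).
  rewrite specfunZ specfunB.
  by apply: specfun_eq => l; exact: kappaE.
rewrite /= !(specfunM _ Bu).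
rewrite (@specfun_eq _ _ B d _ (fun a => (Num.sqrt (1 + a * t))^-1 ^+ 3)).
  by apply: is_derive_specfun => l; exact: is_derive_kappa.
by move=> l; rewrite !exprS expr0 mulr1 mulrA.
Qed.

Section CoefficientFlow.
Variables (R : realType) (J : nat).

Definition centering : 'M[R]_J := 1%:M - J%:R^-1 *: const_mx 1.
Local Notation P := (centering).

Lemma trmx_centering : P^T = P.
Proof. by rewrite /P linearB/= linearZ/= trmx1 trmx_const. Qed.

Lemma mul_centering_const n (w : 'rV[R]_n) :
  P *m ((const_mx 1 : 'cV[R]_J) *m w) = 0.
Proof.
rewrite mulmxA (_ : P *m const_mx 1 = 0 :> 'cV_J) ?mul0mx//.
apply/matrixP => i j; rewrite /P mulmxBl mul1mx -scalemxAl !mxE.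
rewrite (eq_bigr (fun=> 1)) => [|k _]; last by rewrite !mxE mulr1.
rewrite sumr_const card_ord mulVf ?subrr// pnatr_eq0.
by case: (J) i => // -[].
Qed.

Lemma mul_centering : P *m P = P.
Proof.
have ones : const_mx 1 = (const_mx 1 : 'cV[R]_J) *m (const_mx 1 : 'rV_J).
  by apply/matrixP => i j; rewrite !mxE big_ord1 !mxE mulr1.
rewrite {2}/P mulmxBr mulmx1 -scalemxAr.
by rewrite ones mul_centering_const scaler0 subr0.
Qed.

(** The vector field of the ensemble flow, in coordinates with respect to the
    initial ensemble. *)
Definition coef_rhs (Q : 'M[R]_J) (w : 'rV[R]_J) (C : 'M[R]_J) : 'M[R]_J :=
  J%:R^-1 *: (((const_mx 1 : 'cV_J) *m w - C *m Q) *m (P *m C)^T *m (P *m C)).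

(** With G = 2 J^-1 P Q P and h, k as in [psd_matrix_flow], the choice
    C = 1 - J^-1 (Q - W) P k gives P C = P h, because P W = 0, and
    (W - C Q) P = (W - Q) P h, because P k Q P = k (P Q P). Hence the vector
    field at C is J^-1 (W - Q) P h^3, which is C'. *)
Lemma coef_flow K (Y : 'M[R]_(K, J)) (w : 'rV[R]_J) :
  exists C : R -> 'M[R]_J, C 0 = 1%:M /\
    forall (t : R) i j, 0 <= t ->
      is_derive t 1 (fun s => C s i j) (coef_rhs (Y^T *m Y) w (C t) i j).
Proof.
rewrite /coef_rhs.
(* The matrices below are kept opaque, since rewriting with distributivity would
   otherwise match sums and products inside their bodies. *)
move: P trmx_centering mul_centering (mul_centering_const w) => p pT pp pW.
move: (_ *m w) pW => W pW; move QE : (Y^T *m Y) => Q.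
have [G GE] : exists G, G = (2 * J%:R^-1) *: (p *m Q *m p) by eexists.
have Gs : G^T = G.
  by rewrite GE -QE linearZ/= !trmx_mul pT trmxK mulmxA.
have Gp (a : 'cV[R]_J) : 0 <= edot a (G *m a).
  rewrite GE edotE -scalemxAl -scalemxAr mxE mulr_ge0//.
  rewrite (_ : _ *m _ = (Y *m p *m a)^T *m (Y *m p *m a)).
    by rewrite -edotE edot_ge0.
  by rewrite -QE !trmx_mul pT !mulmxA.
have [k [k0 ks kc kd]] := psd_matrix_flow Gs Gp.
have PG : p *m G = G by rewrite GE -scalemxAr !mulmxA pp.
have GP : G *m p = G by rewrite GE -scalemxAl -!mulmxA pp.
have [M ME] : exists M, M = - (J%:R^-1 *: ((Q - W) *m p)) by eexists.
exists (fun t => 1%:M + M *m k t); split; first by rewrite k0 mulmx0 addr0.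
move=> t i j t0; have := fun l => kd t l j t0; rewrite /=.
move hE : (1%:M - _) => h hd.
have kG : G *m k t = k t *m G by exact: kc.
have kP : p *m k t = k t *m p by apply: kc; rewrite PG GP.
have hP : p *m h = h *m p.
  rewrite -hE mulmxBr mulmxBl mulmx1 mul1mx -scalemxAr -scalemxAl.
  by rewrite mulmxA PG -mulmxA -kP mulmxA GP.
have hs : h^T = h.
  by rewrite -hE linearB/= linearZ/= trmx1 trmx_mul ks Gs kG.
have PCE : p *m (1%:M + M *m k t) = p *m h.
  rewrite -hE mulmxDr mulmxBr mulmx1; congr (_ + _).
  rewrite -scalemxAr (mulmxA p G) PG ME GE mulNmx mulmxN -!scalemxAl scalerA.
  rewrite mulrA mulVf ?pnatr_eq0// mul1r -scalemxAr; congr (- (_ *: _)).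
  by rewrite !mulmxA mulmxBr pW subr0.
have MQ : (W - (1%:M + M *m k t) *m Q) *m p = (W - Q) *m p *m h.
  have WE : (W - (1%:M + M *m k t) *m Q) *m p =
      (W - Q) *m p - M *m k t *m Q *m p.
    by rewrite (mulmxDl 1%:M) mul1mx opprD addrA mulmxBl.
  rewrite WE -hE mulmxBr mulmx1; congr (_ - _).
  rewrite ME !mulNmx -!scalemxAl -scalemxAr.
  have -> : (Q - W) *m p *m k t *m Q *m p =
      (Q - W) *m p *m (k t *m (p *m Q *m p)).
    by rewrite !mulmxA -(mulmxA _ (k t) p) -kP !mulmxA -(mulmxA _ p p) pp.
  rewrite kG GE -(opprB Q W) !mulNmx scalerN -!scalemxAr scalerA mulrA.
  by rewrite mulVf ?pnatr_eq0// mul1r.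
rewrite PCE trmx_mul hs pT -hP.
have -> : J%:R^-1 *: ((W - (1%:M + M *m k t) *m Q) *m (p *m h) *m (p *m h)) =
    M *m (h *m h *m h).
  rewrite -(mulmxA _ (p *m h)).
  rewrite (_ : p *m h *m (p *m h) = p *m h *m h); last first.
    by rewrite (mulmxA _ p) -(mulmxA p h p) -hP (mulmxA p p) pp.
  rewrite !mulmxA MQ ME -(opprB Q W) !mulNmx scalerN.
  by rewrite -!scalemxAl.
rewrite mxE (_ : (fun s => _) =
   cst (1%:M i j) + \sum_l (M i l \*: (fun s => k s l j))); last first.
  by apply/funext => s; rewrite !mxE fctE fct_sumE.
rewrite -[X in is_derive _ _ _ X]add0r.
exact: is_deriveD.
Qed.

End CoefficientFlow.

(** * Differentiating the squared Hilbert norm *)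

Section InnerProduct.
Variables (R : realType) (X : normedModType R) (ip : {dot X for (@idfun R)}).
Hypothesis hip : norm_of_inner ip.
Implicit Types x y : X.

Lemma ipC x y : ip x y = ip y x.
Proof. by rewrite hermC/= expr0 mul1r. Qed.

Lemma sqr_normD x y : `|x + y| ^+ 2 = `|x| ^+ 2 + 2 * ip x y + `|y| ^+ 2.
Proof. by rewrite !hip linearDl/= !linearDr/= (ipC y x); ring. Qed.

Lemma ip_polarization x y :
  ip x y = 2^-1 * (`|x + y| ^+ 2 - `|x| ^+ 2 - `|y| ^+ 2).
Proof. by rewrite sqr_normD; field. Qed.

(** Cauchy-Schwarz is read off from the triangle inequality, the norm being
    the one of the inner product. *)
Lemma ip_le x y : ip x y <= `|x| * `|y|.
Proof.
have : `|x + y| ^+ 2 <= (`|x| + `|y|) ^+ 2.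
  by rewrite lerXn2r ?nnegrE ?addr_ge0// ler_normD.
rewrite sqr_normD sqrrD; lra.
Qed.

(** By polarization, joint continuity of the inner product reduces to
    continuity of the norm. *)
Lemma cvg_ip T (F : set_system T) (FF : Filter F) (f g : T -> X) x y :
  f @ F --> x -> g @ F --> y -> ip (f t) (g t) @[t --> F] --> ip x y.
Proof.
move=> fx gy; rewrite ip_polarization.
under eq_fun do rewrite ip_polarization.
apply: cvgMr; apply: cvgB; first apply: cvgB.
- rewrite expr2; under eq_fun do rewrite expr2.
  by apply: cvgM; apply: cvg_norm; apply: cvgD.
- by rewrite expr2; under eq_fun do rewrite expr2; apply: cvgM; apply: cvg_norm.
- by rewrite expr2; under eq_fun do rewrite expr2; apply: cvgM; apply: cvg_norm.
Qed.

(** The difference quotient of the squared norm is the inner product of the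
    difference quotient of [f] with f(t + h) + f(t). *)
Lemma is_derive_sqr_norm (f : R -> X) (t : R) (df : X) :
  is_derive t 1 f df -> is_derive t 1 (fun s => `|f s| ^+ 2) (2 * ip (f t) df).
Proof.
move=> [dft dfE].
have ft : f (h *: 1 + t) @[h --> 0^'] --> f t.
  have ht : h *: (1 : R) + t @[h --> (0 : R)^'] --> t.
    have : h *: (1 : R) + t @[h --> (0 : R)] --> 0 *: (1 : R) + t.
      by apply: cvgD; [apply: cvgZr_tmp; exact: cvg_id | exact: cvg_cst].
    by rewrite scale0r add0r; exact: cvg_within_filter.
  apply: cvg_comp ht _.
  by move/derivable1_diffP/differentiable_continuous : dft; exact.
suff lim : h^-1 *: ((`|f (h *: 1 + t)| ^+ 2 : R) - `|f t| ^+ 2) @[h --> 0^']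
    --> (2 * ip (f t) df : R).
  split; first by apply/cvg_ex; exists (2 * ip (f t) df).
  by apply/cvg_lim.
have -> : 2 * ip (f t) df = ip df (f t + f t).
  by rewrite linearDr/= (ipC df) mulrDl mul1r.
under eq_fun => h.
  rewrite (_ : _ *: _ =
    ip (h^-1 *: (f (h *: 1 + t) - f t)) (f (h *: 1 + t) + f t)).
  over.
  rewrite linearZl/= linearBl/= !linearDr/= (ipC (f t) (f _)) !hip.
  by rewrite /GRing.scale/=; ring.
apply: cvg_ip; last exact: cvgD ft (cvg_cst _).
by rewrite -dfE.
Qed.

End InnerProduct.

(** * Uniqueness by Gronwall's inequality *)

(** The function e^(- c t) phi(t) is nonincreasing. *)
Lemma gronwall (R : realType) (phi dphi : R -> R) (b c : R) : 0 <= b ->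
  {within `[0, b], continuous phi} ->
  (forall t, 0 < t < b -> is_derive t 1 phi (dphi t)) ->
  (forall t, 0 < t < b -> dphi t <= c * phi t) ->
  phi b <= expR (c * b) * phi 0.
Proof.
move=> b0 phic phid phile.
pose e (s : R) := expR (- c * s).
have ed (t : R) : is_derive t 1 e (- c * e t).
  apply: is_derive_eq.
  by rewrite -[(- c) *: _]/(- c * 1) mulr1 mulrC.
have psid t : 0 < t < b ->
    is_derive t 1 (e * phi) (e t * dphi t + phi t * (- c * e t)).
  by move=> /phid h; exact: (is_deriveM (ed t) h).
have : (e * phi) b <= (e * phi) 0.
  apply: (@ler0_derive1_le_cc _ (e * phi) 0 b).
  - by move=> t; rewrite in_itv/= => /psid[].
  - move=> t; rewrite in_itv/= => tb; have [_] := psid t tb.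
    rewrite derive1E => ->.
    have -> : e t * dphi t + phi t * (- c * e t) =
      e t * (dphi t - c * phi t) by ring.
    by rewrite pmulr_rle0 ?expR_gt0// subr_le0 phile.
  - move=> x; apply: continuousM; last exact: phic.
    apply: (@continuous_subspaceT _ _ _ e) => y.
    by apply/differentiable_continuous/derivable1_diffP; case: (ed y).
  - by rewrite in_itv/= b0 lexx.
  - by rewrite in_itv/= b0 lexx.
  - by [].
rewrite /= -[(e * phi) b]/(e b * phi b) -[(e * phi) 0]/(e 0 * phi 0).
rewrite {2}/e mulr0 expR0 mul1r /e mulNr expRN.
by rewrite mulrC ler_pdivrMr ?expR_gt0// mulrC.
Qed.

Section Uniqueness.
Variables (R : realType) (X : normedModType R) (J : nat).
Implicit Types u v : 'I_J -> X.

Definition lipschitz_on_balls (Y : normedModType R) (g : ('I_J -> X) -> Y) :=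
  forall B : R, exists2 L : R, 0 <= L &
    forall u v, (forall j, `|u j| <= B) -> (forall j, `|v j| <= B) ->
      `|g u - g v| <= L * \sum_(j < J) `|u j - v j|.

Lemma lipschitz_on_ballsD (Y : normedModType R) (f g : ('I_J -> X) -> Y) :
  lipschitz_on_balls f -> lipschitz_on_balls g ->
  lipschitz_on_balls (fun u => f u + g u).
Proof.
move=> fl gl B; have [L L0 fL] := fl B; have [M M0 gM] := gl B.
exists (L + M); first exact: addr_ge0.
move=> u v uB vB; rewrite opprD addrACA mulrDl.
by rewrite (le_trans (ler_normD _ _))// lerD ?fL ?gM.
Qed.

Lemma lipschitz_on_balls_cst (Y : normedModType R) (y : Y) :
  lipschitz_on_balls (fun=> y).
Proof.
by move=> B; exists 0 => // u v _ _; rewrite subrr normr0 mul0r.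
Qed.

Lemma lipschitz_on_balls_sum (Y : normedModType R) n
    (f : 'I_n -> ('I_J -> X) -> Y) :
  (forall i, lipschitz_on_balls (f i)) ->
  lipschitz_on_balls (fun u => \sum_(i < n) f i u).
Proof.
elim: n f => [|n ih] f fl.
  have -> : (fun u => \sum_(i < 0) f i u) = fun=> 0.
    by apply/funext => u; rewrite big_ord0.
  exact: lipschitz_on_balls_cst.
have -> : (fun u => \sum_(i < n.+1) f i u) =
    fun u => \sum_(i < n) f (widen_ord (leqnSn n) i) u + f ord_max u.
  by apply/funext => u; rewrite big_ord_recr.
by apply: lipschitz_on_ballsD => //; apply: ih.
Qed.

(** Products preserve the property because a map that is Lipschitz on a ball is
    bounded there, by comparison with its value at the zero ensemble. *)
Lemma lipschitz_on_ballsZ (Y : normedModType R) (a : ('I_J -> X) -> R)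
    (f : ('I_J -> X) -> Y) :
  lipschitz_on_balls a -> lipschitz_on_balls f ->
  lipschitz_on_balls (fun u => a u *: f u).
Proof.
move=> al fl B.
(* The zero ensemble has to lie in the ball, also when B is negative. *)
pose B' := Num.max B 0.
have [L L0 aL] := al B'; have [M M0 fM] := fl B'.
have B'0 : 0 <= B' by rewrite le_max lexx orbT.
have bnd (Z : normedModType R) (g : ('I_J -> X) -> Z) N : 0 <= N ->
    (forall u v, (forall j, `|u j| <= B') -> (forall j, `|v j| <= B') ->
      `|g u - g v| <= N * \sum_(j < J) `|u j - v j|) ->
    forall u, (forall j, `|u j| <= B') ->
      `|g u| <= N * (J%:R * B') + `|g (fun=> 0)|.
  move=> N0 gN u uB; rewrite -[g u](subrK (g (fun=> 0))).
  rewrite (le_trans (ler_normD _ _))// lerD2r.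
  rewrite (le_trans (gN _ _ _ _))// => [j|]; first by rewrite normr0.
  rewrite ler_wpM2l// mulr_natl -[X in _ *+ X]card_ord -sumr_const.
  rewrite ler_sum// => j _.
  by rewrite subr0.
pose Ca := L * (J%:R * B') + `|a (fun=> 0)|.
pose Cf := M * (J%:R * B') + `|f (fun=> 0)|.
have Ca0 : 0 <= Ca by rewrite addr_ge0// !mulr_ge0.
have Cf0 : 0 <= Cf by rewrite addr_ge0// !mulr_ge0.
exists (Ca * M + L * Cf); first by rewrite addr_ge0// mulr_ge0.
move=> u v uB vB.
have uB' j : `|u j| <= B' by rewrite le_max uB.
have vB' j : `|v j| <= B' by rewrite le_max vB.
have -> : a u *: f u - a v *: f v = a u *: (f u - f v) + (a u - a v) *: f v.
  by rewrite scalerBr scalerBl addrA subrK.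
rewrite (le_trans (ler_normD _ _))// !normrZ mulrDl lerD//.
  by rewrite -mulrA ler_pM ?fM ?bnd.
by rewrite mulrAC ler_pM ?aL ?bnd.
Qed.

Lemma lipschitz_on_balls_coord j : lipschitz_on_balls (fun u => u j).
Proof.
move=> B; exists 1 => // u v _ _; rewrite mul1r (bigD1 j)//= lerDl.
exact: sumr_ge0.
Qed.

Lemma lipschitz_on_ballsZl (Y : normedModType R) (c : R)
    (f : ('I_J -> X) -> Y) :
  lipschitz_on_balls f -> lipschitz_on_balls (fun u => c *: f u).
Proof.
by move=> fl; apply: lipschitz_on_ballsZ => //; exact: lipschitz_on_balls_cst.
Qed.

Lemma lipschitz_on_ballsB (Y : normedModType R) (f g : ('I_J -> X) -> Y) :
  lipschitz_on_balls f -> lipschitz_on_balls g ->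
  lipschitz_on_balls (fun u => f u - g u).
Proof.
move=> fl gl; apply: lipschitz_on_ballsD => //.
have -> : (fun u => - g u) = (fun u => -1 *: g u).
  by apply/funext => u; rewrite scaleN1r.
exact: lipschitz_on_ballsZl.
Qed.

Lemma lipschitz_on_balls_linear (Y Z : normedModType R) (l : Y -> Z) (M : R)
    (f : ('I_J -> X) -> Y) :
  additive l -> (forall y, `|l y| <= M * `|y|) ->
  lipschitz_on_balls f -> lipschitz_on_balls (fun u => l (f u)).
Proof.
move=> la lM fl B; have [L L0 fL] := fl B.
exists (`|M| * L); first by rewrite mulr_ge0.
move=> u v uB vB; rewrite -la (le_trans (lM _))//.
rewrite -mulrA (le_trans (ler_wpM2r _ (ler_norm M)))//.
by rewrite ler_wpM2l// fL.
Qed.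

Variable ip : {dot X for (@idfun R)}.
Hypothesis hip : norm_of_inner ip.

(** The estimate 2 a b <= a^2 + b^2 turns the Lipschitz bound into the
    differential inequality that Gronwall requires. *)
Lemma sum_ip_le (w d : 'I_J -> X) L : 0 <= L ->
  (forall j, `|d j| <= L * \sum_(k < J) `|w k|) ->
  \sum_(j < J) 2 * ip (w j) (d j) <= 2 * L * J%:R * \sum_(j < J) `|w j| ^+ 2.
Proof.
move=> L0 dL.
have h j : 2 * ip (w j) (d j) <= L * \sum_(k < J) (`|w j| ^+ 2 + `|w k| ^+ 2).
  apply: (@le_trans _ _ (2 * (`|w j| * (L * \sum_(k < J) `|w k|)))).
    rewrite ler_wpM2l// (le_trans (ip_le hip _ _))//.
    by rewrite ler_wpM2l.
  have -> : 2 * (`|w j| * (L * \sum_(k < J) `|w k|)) =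
      L * \sum_(k < J) 2 * `|w j| * `|w k| by rewrite -mulr_sumr; ring.
  rewrite ler_wpM2l// ler_sum// => k _.
  by have := sqr_ge0 (`|w j| - `|w k|); rewrite sqrrB; lra.
apply: (le_trans (ler_sum _ (fun j _ => h j))).
rewrite -mulr_sumr -(mulrA 2) (mulrCA 2) -!mulrA ler_wpM2l//.
under eq_bigr do rewrite big_split/= sumr_const card_ord.
rewrite big_split/= sumr_const card_ord sumrMnl.
set S := \sum_(j < J) _.
by rewrite !mulr_natl -mulr2n.
Qed.

(** On [0, t] with t < T both solutions stay in a common ball, where one
    Lipschitz constant serves all components. *)
Lemma ode_unique (F : 'I_J -> ('I_J -> X) -> X) (T : R) (U V : 'I_J -> R -> X) :
  (forall j, lipschitz_on_balls (F j)) ->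
  (forall j, {within `[0, T[, continuous (U j)}) ->
  (forall j, {within `[0, T[, continuous (V j)}) ->
  (forall j, U j 0 = V j 0) ->
  (forall j (t : R), 0 < t < T -> is_derive t 1 (U j) (F j (U ^~ t))) ->
  (forall j (t : R), 0 < t < T -> is_derive t 1 (V j) (F j (V ^~ t))) ->
  forall j t, 0 <= t < T -> U j t = V j t.
Proof.
move=> Fl Uc Vc UV0 Ud Vd j t /andP[t0 tT].
have sub : `[0, t] `<=` `[0, T[.
  by move=> s /=; rewrite !in_itv/= => /andP[-> /le_lt_trans ->].
have bounded (W : 'I_J -> R -> X) :
    (forall j, {within `[0, T[, continuous (W j)}) ->
    {M : 'I_J -> R & forall j s, 0 <= s <= t -> `|W j s| <= M j}.
  move=> Wc.
  apply: (@choice _ _ (fun j M => forall s, 0 <= s <= t -> `|W j s| <= M)) => i.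
  have [|c _ cM] := @EVT_max R (fun s => `|W i s|) 0 t t0.
    by move=> x; apply: cvg_norm; exact: (continuous_subspaceW sub (Wc i)).
  by exists `|W i c| => s st; apply: cM; rewrite in_itv.
have [M_U hMU] := bounded U Uc; have [M_V hMV] := bounded V Vc.
have M_U0 i : 0 <= M_U i by apply: le_trans (hMU i 0 _); rewrite ?lexx.
have M_V0 i : 0 <= M_V i by apply: le_trans (hMV i 0 _); rewrite ?lexx.
pose M i := M_U i + M_V i.
have MU i s : 0 <= s <= t -> `|U i s| <= M i.
  by move=> /hMU h; rewrite (le_trans (h i))// lerDl.
have MV i s : 0 <= s <= t -> `|V i s| <= M i.
  by move=> /hMV h; rewrite (le_trans (h i))// lerDr.
have M0 i : 0 <= M i.
  by apply: le_trans (MU i 0 _); rewrite ?lexx.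
pose B := \sum_i M i.
have MB i : M i <= B by rewrite /B (bigD1 i)//= lerDl sumr_ge0.
have /choice[L hL] : forall i, exists L : R, 0 <= L /\
    forall u v, (forall j, `|u j| <= B) -> (forall j, `|v j| <= B) ->
      `|F i u - F i v| <= L * \sum_(j < J) `|u j - v j|.
  by move=> i; have [L L0 hL] := Fl i B; exists L.
pose c := \sum_i L i.
have c0 : 0 <= c by apply: sumr_ge0 => i _; case: (hL i).
have Lc i : L i <= c.
  by rewrite /c (bigD1 i)//= lerDl sumr_ge0// => k _; case: (hL k).
pose phi (s : R) := \sum_i `|U i s - V i s| ^+ 2.
pose dphi (s : R) :=
  \sum_i 2 * ip (U i s - V i s) (F i (U ^~ s) - F i (V ^~ s)).
have phit : phi t <= expR (2 * c * J%:R * t) * phi 0.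
  apply: (@gronwall R phi dphi t) => //.
  - have -> : phi = \sum_i (fun s => `|U i s - V i s| ^+ 2).
      by apply/funext => s; rewrite fct_sumE.
    apply: (big_ind (fun f : R -> R => {within `[0, t], continuous f})).
    + by move=> s; exact: cvg_cst.
    + by move=> f g fc gc s; apply: cvgD; [exact: fc | exact: gc].
    move=> i _.
    have nc : {within `[0, t], continuous (fun s => `|U i s - V i s|)}.
      move=> s; apply: cvg_norm; apply: cvgB.
        exact: (continuous_subspaceW sub (Uc i)).
      exact: (continuous_subspaceW sub (Vc i)).
    by move=> s; exact: (continuousM (nc s) (nc s)).
  - move=> s /andP[s0 st]; have sT : 0 < s < T by rewrite s0 (lt_trans st).
    have -> : phi = \sum_i (fun s => `|U i s - V i s| ^+ 2).
      by apply/funext => r; rewrite fct_sumE.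
    apply: is_derive_sum => i.
    apply: (is_derive_sqr_norm hip (f := fun r => U i r - V i r)).
    exact: (is_deriveB (Ud i s sT) (Vd i s sT)).
  - move=> s /andP[/ltW s0 /ltW st]; have ss : 0 <= s <= t by rewrite s0.
    apply: sum_ip_le => // i.
    have [_ hLi] := hL i; apply: le_trans (hLi _ _ _ _) _.
    + by move=> k; rewrite (le_trans (MU _ _ ss)).
    + by move=> k; rewrite (le_trans (MV _ _ ss)).
    + by rewrite ler_wpM2r// sumr_ge0.
have phi0 : phi 0 = 0.
  by rewrite /phi big1// => i _; rewrite UV0 subrr normr0 expr0n.
move: phit; rewrite phi0 mulr0 => phit.
have le0 : `|U j t - V j t| ^+ 2 <= 0.
  apply: le_trans phit; rewrite /phi (bigD1 j)//= lerDl.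
  by apply: sumr_ge0 => i _; rewrite sqr_ge0.
apply/eqP; rewrite -subr_eq0 -normr_eq0 -sqrf_eq0.
by rewrite eq_le le0 sqr_ge0.
Qed.

End Uniqueness.

(** * The ensemble flow *)

Lemma is_derive_scaler (R : realType) (X : normedModType R) (f : R -> R) (x : X)
    (t df : R) :
  is_derive t 1 f df -> is_derive t 1 (fun s => f s *: x) (df *: x).
Proof.
move=> [dft <-].
have lim : h^-1 *: (f (h *: 1 + t) *: x - f t *: x) @[h --> (0 : R)^'] -->
    'D_1 f t *: x.
  under eq_fun do rewrite -scalerBl scalerA.
  exact: (cvgZr_tmp (a := x) dft).
by split; [apply/cvg_ex; exists ('D_1 f t *: x) | apply/cvg_lim].
Qed.

Section Enkf.
Variables (R : realType) (X : normedModType R) (K J : nat).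
Variables (A : {linear X -> 'cV[R]_K}) (Gamma : 'M[R]_K) (y : 'cV[R]_K).

Lemma bounded_op_coord (L : 'M[R]_K) i : bounded_op A ->
  exists M : R, forall x, `|(L *m A x) i 0| <= M * `|x|.
Proof.
move=> [M hM]; exists (\sum_k `|L i k| * M) => x.
rewrite mxE mulr_suml (le_trans (ler_norm_sum _ _ _))// ler_sum// => k _.
rewrite normrM -mulrA ler_wpM2l// (le_trans _ (hM x))//.
rewrite [leRHS]/Num.Def.normr/= mx_normrE.
exact: (le_bigmax _ (fun ij => `|A x ij.1 ij.2|) (k, 0)).
Qed.

Lemma enkf_rhs_lipschitz j : bounded_op A ->
  lipschitz_on_balls (fun u : 'I_J -> X => enkf_rhs A Gamma y u j).
Proof.
move=> hA; apply: lipschitz_on_ballsZl; apply: lipschitz_on_balls_sum => k.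
have devl : lipschitz_on_balls (fun u : 'I_J -> X => u k - emean u).
  apply: lipschitz_on_ballsB; first exact: lipschitz_on_balls_coord.
  apply: lipschitz_on_ballsZl; apply: lipschitz_on_balls_sum => i.
  exact: lipschitz_on_balls_coord.
apply: lipschitz_on_ballsZ => //.
set L := invmx (sqrtmx Gamma).
apply: lipschitz_on_balls_sum => i; have [M hM] := bounded_op_coord L i hA.
have La : additive (fun x => (L *m A x) i 0 : R).
  by move=> a b; rewrite linearB mulmxBr !mxE.
apply: (lipschitz_on_ballsZ (Y := R)).
  exact: (lipschitz_on_balls_linear La hM).
have -> : (fun u : 'I_J -> X => (L *m (y - A (u j))) i 0) =
    fun u => (L *m y) i 0 - (L *m A (u j)) i 0.
  by apply/funext => u; rewrite mulmxBr !mxE.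
apply: lipschitz_on_ballsB; first exact: lipschitz_on_balls_cst.
apply: (lipschitz_on_balls_linear La hM); exact: lipschitz_on_balls_coord.
Qed.

Variable u0 : 'I_J -> X.

Definition combination (C : 'M[R]_J) (j : 'I_J) : X :=
  \sum_(i < J) C j i *: u0 i.

Lemma combination1 j : combination 1%:M j = u0 j.
Proof.
rewrite /combination (bigD1 j)//= mxE eqxx scale1r big1 ?addr0// => i ij.
by rewrite mxE eq_sym (negPf ij) scale0r.
Qed.

Lemma combinationZ c C j : combination (c *: C) j = c *: combination C j.
Proof.
by rewrite /combination scaler_sumr; apply: eq_bigr => i _; rewrite mxE scalerA.
Qed.

Lemma combinationM (B C : 'M[R]_J) j :
  combination (B *m C) j = \sum_(k < J) B j k *: combination C k.
Proof.
rewrite /combination; under eq_bigr do rewrite mxE scaler_suml.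
rewrite exchange_big; apply: eq_bigr => k _; rewrite scaler_sumr.
by apply: eq_bigr => i _; rewrite scalerA.
Qed.

Lemma combination_centering C j :
  combination C j - emean (combination C) = combination (centering R J *m C) j.
Proof.
rewrite /centering mulmxBl mul1mx -scalemxAl.
have -> : combination (C - J%:R^-1 *: (const_mx 1 *m C)) j =
    combination C j - combination (J%:R^-1 *: (const_mx 1 *m C)) j.
  rewrite /combination -sumrB; apply: eq_bigr => i _.
  by rewrite 2!mxE scalerBl.
rewrite combinationZ combinationM; congr (_ - _ *: _).
by apply: eq_bigr => k _; rewrite mxE scale1r.
Qed.

(** Column i is the observation A u^(i)(0) in coordinates where the weighted
    inner product becomes the Euclidean one. *)
Definition whitened_obs : 'M[R]_(K, J) :=
  \matrix_(k, i) (invmx (sqrtmx Gamma) *m A (u0 i)) k 0.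

Lemma whitened_combination C j :
  invmx (sqrtmx Gamma) *m A (combination C j) = whitened_obs *m (row j C)^T.
Proof.
rewrite /combination linear_sum mulmx_sumr; apply/colP => k.
rewrite summxE [RHS]mxE; apply: eq_bigr => i _.
by rewrite linearZ -scalemxAr !mxE mulrC.
Qed.

(** The weighted inner product of a deviation with a residual is an entry of
    E (W - C Q)^T, E being the coordinates of the deviations; summing against
    the deviations multiplies the transpose of this matrix by E. *)
Lemma enkf_rhs_combination C j :
  enkf_rhs A Gamma y (combination C) j =
  combination (coef_rhs (whitened_obs^T *m whitened_obs)
    ((invmx (sqrtmx Gamma) *m y)^T *m whitened_obs) C) j.
Proof.
rewrite /coef_rhs combinationZ combinationM /enkf_rhs; congr (_ *: _).
apply: eq_bigr => k _; rewrite combination_centering; congr (_ *: _).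
set E := centering R J *m C; set Y := whitened_obs.
rewrite /wdot mulmxBr !whitened_combination -/Y.
set z := invmx _ *m y.
have -> (a b : 'cV[R]_K) : edot a b = edot b a.
  by apply: eq_bigr => i _; rewrite mulrC.
move: z Y E => z Y E.
rewrite edotE linearB/= trmx_mul trmxK.
have mulmx_trE (B D : 'M[R]_J) : (B *m D^T) j k = (row j B *m (row k D)^T) 0 0.
  by rewrite !mxE; apply: eq_bigr => i _; rewrite !mxE.
rewrite mulmx_trE linearB/= !row_mul row_const.
have -> : const_mx 1 = 1%:M :> 'M[R]_1.
  by apply/matrixP => a b; rewrite !ord1 !mxE.
by rewrite mul1mx !mulmxA mulmxBl -!mulmxA mulmxBl !mulmxA.
Qed.

(** The coordinates are differentiable on both sides at every t >= 0, so the
    one-sided derivative at 0 is part of the two-sided one. *)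
Lemma enkf_solution_exists T : exists U : 'I_J -> R -> X,
  enkf_solution A Gamma y u0 T U.
Proof.
have [C [C0 Cd]] := coef_flow whitened_obs
  ((invmx (sqrtmx Gamma) *m y)^T *m whitened_obs).
pose U j t := combination (C t) j.
have Ud j (t : R) : 0 <= t ->
    is_derive t 1 (U j) (enkf_rhs A Gamma y (U ^~ t) j).
  move=> t0; rewrite (_ : U ^~ t = combination (C t))// enkf_rhs_combination.
  rewrite (_ : U j = \sum_i (fun s => C s j i *: u0 i)); last first.
    by apply/funext => s; rewrite fct_sumE.
  apply: is_derive_sum => i.
  exact: is_derive_scaler (Cd t j i t0).
exists U => F j; rewrite /F; split.
- apply: derivable_within_continuous => t; rewrite in_itv/= => /andP[t0 _].
  by case: (Ud j t t0).
- by move=> t _; exists (C t j).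
- by rewrite /U C0 combination1.
- by move=> t /andP[/ltW t0 _]; exact: Ud.
have [d0 <-] := Ud j 0 (lexx _).
apply: cvg_dnbhs_at_right; move: d0; rewrite /derivable /derive.
rewrite (_ : (fun h : R => _) = fun h => h^-1 *: (U j h - U j 0))//.
by apply/funext => h /=; rewrite addr0 /GRing.scale/= mulr1.
Qed.

End Enkf.

Theorem theorem3p1 (R : realType) (X : completeNormedModType R)
    (ip : {dot X for (@idfun R)}) (hip : norm_of_inner ip)
    (hsep : separable X)
    (K J : nat)
    (A : {linear X -> 'cV[R]_K}) (hA : bounded_op A)
    (Gamma : 'M[R]_K) (hGamma : posdefmx Gamma)
    (udag : X) (etadag ydag : 'cV[R]_K) (hy : ydag = A udag + etadag)
    (u0 : 'I_J -> X) (T : R) (hT : 0 < T) :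
  exists U : 'I_J -> R -> X,
    enkf_solution A Gamma ydag u0 T U /\
    forall V : 'I_J -> R -> X, enkf_solution A Gamma ydag u0 T V ->
      forall (j : 'I_J) (t : R), 0 <= t < T -> V j t = U j t.
Proof.
have [U hU] := enkf_solution_exists A Gamma ydag u0 T.
exists U; split=> // V hV.
apply: (ode_unique hip (F := fun j u => enkf_rhs A Gamma ydag u j)).
- by move=> j; exact: enkf_rhs_lipschitz.
- by move=> j; have [] := hV j.
- by move=> j; have [] := hU j.
- by move=> j; have [_ _ -> _ _] := hV j; have [_ _ -> _ _] := hU j.
- by move=> j; have [] := hV j.
- by move=> j; have [] := hU j.
Qed.
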